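(* Let $\mathsf{L}$, $\mathsf{L}'$, $\mathsf{H}$, $\mathsf{H}'$ be simplicial complexes. If $\mathsf{L}'$ is isomorphic to $\mathsf{L}$ and $\mathsf{H}'$ is isomorphic to $\mathsf{H}$, then $$\mathrm{C}(\mathsf{L};\mathsf{H})=\mathrm{C}(\mathsf{L}';\mathsf{H}')\quad\text{and}\quad \mathrm{IC}(\mathsf{L};\mathsf{H})=\mathrm{IC}(\mathsf{L}';\mathsf{H}').$$
   Context: A simplicial complex is an abstract simplicial complex: a set $\mathsf{K}$ of subsets (simplices) of a vertex set $V(\mathsf{K})=\bigcup\mathsf{K}$ such that $F\in\mathsf{K}$ and $G\subseteq F$ imply $G\in\mathsf{K}$. A facet is a simplex that is maximal with respect to inclusion; a facet is non-unitary if it has at least two vertices. A subcomplex of $\mathsf{K}$ is a simplicial complex contained in $\mathsf{K}$. The union of simplicial complexes is the union of their vertex sets and of their sets of simplices. A simplicial map $f:\mathsf{L}\to\mathsf{K}$ is a map $f:V(\mathsf{L})\to V(\mathsf{K})$ such that $f(F)\in\mathsf{K}$ whenever $F\in\mathsf{L}$; it is injective (bijective) if it is injective (bijective) on vertices. An isomorphism is a bijective simplicial map whose inverse is also a simplicial map. A facet simplicial map is a simplicial map $f:\mathsf{L}\to\mathsf{K}$ such that $f(F)$ is a non-unitary facet of $\mathsf{K}$ whenever $F$ is a non-unitary facet of $\mathsf{L}$. The facet-complexity $\mathrm{C}(\mathsf{L};\mathsf{K})$ is the least positive integer $k$ such that there exist subcomplexes $\mathsf{L}_1,\ldots,\mathsf{L}_k$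 of $\mathsf{L}$ with $\mathsf{L}=\mathsf{L}_1\cup\cdots\cup\mathsf{L}_k$ and, for each $i$, a facet simplicial map $f_i:\mathsf{L}_i\to\mathsf{K}$; it is $\infty$ if no such $k$ exists. The injective facet-complexity $\mathrm{IC}(\mathsf{L};\mathsf{K})$ is defined in the same way, requiring each $f_i$ to be an injective facet simplicial map. *)

(* Defs.v *)
From mathcomp Require Import all_boot all_order.
From mathcomp Require Import all_classical.
From mathcomp Require Import constructive_ereal.

Set Implicit Arguments.
Unset Strict Implicit.
Unset Printing Implicit Defensive.

Local Open Scope classical_set_scope.

(* No finiteness is imposed on the complex or on its simplices. The complex
   without simplices and the complex {set0} are both allowed, and differ. *)
Record complex (T : Type) := Complex {
  simplices :> set (set T);
  simplices_sub : forall F G : set T,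
    simplices F -> G `<=` F -> simplices G }.

Definition vertices (T : Type) (K : complex T) : set T :=
  \bigcup_(F in simplices K) F.

Definition facet (T : Type) (K : complex T) (F : set T) : Prop :=
  simplices K F /\ forall G, simplices K G -> F `<=` G -> G = F.

Definition nonunitary (T : Type) (F : set T) : Prop :=
  exists x y, [/\ F x, F y & x <> y].

Definition nonunitary_facet (T : Type) (K : complex T) (F : set T) : Prop :=
  facet K F /\ nonunitary F.

Definition subcomplex (T : Type) (M K : complex T) : Prop :=
  simplices M `<=` simplices K.

(* Vertex maps are functions between the subtypes of vertices, rather than
   total functions T -> U, so that a map out of a complex without vertices
   exists even when U is empty. *)
Definition vmap (T U : Type) (L : complex T) (K : complex U) : Type :=
  vertices L -> vertices K.

Section Maps.
Variables (T U : Type) (L : complex T) (K : complex U).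
Implicit Type f : vmap L K.

Definition vimage f (F : set T) : set U :=
  [set \val (f x) | x in [set x : vertices L | F (\val x)]].

Definition simplicial f : Prop :=
  forall F, simplices L F -> simplices K (vimage f F).

Definition facet_simplicial f : Prop :=
  simplicial f /\
  forall F, nonunitary_facet L F -> nonunitary_facet K (vimage f F).

Definition injective_facet_simplicial f : Prop :=
  facet_simplicial f /\ injective f.

End Maps.

Definition isomorphism (T U : Type) (L : complex T) (K : complex U)
    (f : vmap L K) : Prop :=
  simplicial f /\
  exists g : vmap K L, [/\ cancel f g, cancel g f & simplicial g].

Definition isomorphic (T U : Type) (L : complex T) (K : complex U) : Prop :=
  exists f : vmap L K, isomorphism f.

(* The equality of sets of simplices entails that of vertex sets, see
   [vertices_bigcup]. *)
Definition covered_by (T : Type) (L : complex T) (k : nat)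
    (Ls : 'I_k -> complex T) : Prop :=
  (forall i, subcomplex (Ls i) L) /\
  simplices L = \bigcup_(i in [set: 'I_k]) simplices (Ls i).

Lemma vertices_bigcup (T : Type) (L : complex T) (k : nat)
    (Ls : 'I_k -> complex T) :
  covered_by L Ls -> vertices L = \bigcup_(i in [set: 'I_k]) vertices (Ls i).
Proof.
move=> [_ eL]; rewrite /vertices eL; apply/seteqP; split => x.
- by move=> [F [i _ iF] Fx]; exists i => //; exists F.
- by move=> [i _ [F iF Fx]]; exists F => //; exists i.
Qed.

(* The least natural number satisfying P, and +oo if there is none. *)
Definition least (P : nat -> Prop) : \bar nat :=
  match pselect (exists k, `[< P k >]) with
  | left exP => (ex_minn exP)%:E%E
  | right _ => +oo%E
  end.

Lemma least_fin (P : nat -> Prop) (k : nat) :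
  least P = k%:E%E <-> P k /\ forall j, P j -> k <= j.
Proof.
rewrite /least; case: pselect => [exP|nP]; last first.
  by split=> // -[Pk _]; case: nP; exists k; apply/asboolP.
case: ex_minnP => m /asboolP Pm minm; split=> [[<-]|[Pk mink]].
  by split=> // j Pj; apply: minm; apply/asboolP.
congr (_%:E)%E; apply/eqP; rewrite eqn_leq mink // andbT.
by apply: minm; apply/asboolP.
Qed.

Lemma least_infty (P : nat -> Prop) :
  least P = +oo%E <-> forall k, ~ P k.
Proof.
rewrite /least; case: pselect => [exP|nP]; split=> //.
  by have [k /asboolP Pk] := exP => /(_ k).
by move=> _ k Pk; apply: nP; exists k; apply/asboolP.
Qed.

Definition facet_complexity (T U : Type) (L : complex T) (K : complex U) :
    \bar nat :=
  least (fun k => 0 < k /\ exists Ls : 'I_k -> complex T,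
    covered_by L Ls /\
    forall i, exists f : vmap (Ls i) K, facet_simplicial f).

Definition injective_facet_complexity (T U : Type) (L : complex T)
    (K : complex U) : \bar nat :=
  least (fun k => 0 < k /\ exists Ls : 'I_k -> complex T,
    covered_by L Ls /\
    forall i, exists f : vmap (Ls i) K, injective_facet_simplicial f).

(* Main.v *)
Require Import Defs.
From mathcomp Require Import all_boot all_order.
From mathcomp Require Import all_classical.
From mathcomp Require Import constructive_ereal.

(** Isomorphisms and their inverses are injective facet simplicial maps, and
  such maps compose. A cover of [L] pulls back along an isomorphism [L' -> L]
  to a cover of [L'] whose members are isomorphic to those of the cover of [L],
  so composing with isomorphisms on both sides transports the witnesses of
  either complexity. *)

Set Implicit Arguments.
Unset Strict Implicit.
Unset Printing Implicit Defensive.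

Local Open Scope classical_set_scope.

Lemma vertices_simplex (T : Type) (K : complex T) (F : set T) :
  simplices K F -> F `<=` vertices K.
Proof. by move=> KF x Fx; exists F. Qed.

Lemma vertices_subcomplex (T : Type) (M K : complex T) :
  subcomplex M K -> vertices M `<=` vertices K.
Proof. by move=> MK x [F /MK KF Fx]; exists F. Qed.

Section VertexImages.
Variables (T U : Type) (L : complex T) (K : complex U).
Implicit Type f : vmap L K.

Lemma vimage_val f (F : set T) (x : vertices L) :
  F (\val x) -> vimage f F (\val (f x)).
Proof. by move=> Fx; exists x. Qed.

Lemma vimageS f (F G : set T) : F `<=` G -> vimage f F `<=` vimage f G.
Proof. by move=> FG _ [x Fx <-]; exists x => //; exact: FG. Qed.

End VertexImages.

Section VertexMaps.
Variables (T U V : Type) (L : complex T) (K : complex U) (N : complex V).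
Implicit Types (f : vmap L K) (g : vmap K N) (h : vmap K L).

Lemma vimage_comp g f (F : set T) :
  vimage (g \o f : vmap L N) F = vimage g (vimage f F).
Proof.
apply/seteqP; split=> [_ [x Fx <-]|_ [y [x Fx /val_inj <-] <-]].
  by exists (f x) => //; exact: vimage_val.
by exists x.
Qed.

(** The inclusion in [vertices L] matters: [vimage] discards the points of [F] that are not
    vertices, and no second image can bring them back. *)
Lemma vimageK f h (F : set T) : cancel f h -> F `<=` vertices L ->
  vimage h (vimage f F) = F.
Proof.
move=> fK FL; apply/seteqP; split=> [_ [y [x Fx /val_inj <-] <-]|x Fx].
  by rewrite fK.
pose v : vertices L := exist _ x (mem_set (FL _ Fx)).
by exists (f v); [exact: vimage_val | rewrite fK].
Qed.

Lemma facet_simplicial_comp g f :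
  facet_simplicial f -> facet_simplicial g ->
  facet_simplicial (g \o f : vmap L N).
Proof.
move=> [sf ff] [sg fg]; split=> F LF; rewrite vimage_comp.
  exact/sg/sf.
exact/fg/ff.
Qed.

Lemma injective_facet_simplicial_comp g f :
  injective_facet_simplicial f -> injective_facet_simplicial g ->
  injective_facet_simplicial (g \o f : vmap L N).
Proof.
move=> [ff fI] [fg gI]; split; first exact: facet_simplicial_comp.
exact: inj_comp.
Qed.

Lemma nonunitary_vimage f (F : set T) : injective f -> F `<=` vertices L ->
  nonunitary F -> nonunitary (vimage f F).
Proof.
move=> fI FL [x [y [Fx Fy xy]]].
pose u : vertices L := exist _ x (mem_set (FL _ Fx)).
pose v : vertices L := exist _ y (mem_set (FL _ Fy)).
exists (\val (f u)), (\val (f v)); split; [exact: vimage_val..|].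
by move=> /val_inj /fI /(congr1 val).
Qed.

End VertexMaps.

(** Maximality travels through the inverse [g]: if a simplex [G] contains the image of a facet [F],
    then the image of [G] under [g] is a simplex containing [F], hence equals [F], and applying [f]
    gives back [G]. Injectivity keeps two distinct vertices distinct. *)
Lemma isomorphism_injective_facet_simplicial (T U : Type) (L : complex T)
    (K : complex U) (f : vmap L K) :
  isomorphism f -> injective_facet_simplicial f.
Proof.
move=> [sf [g [fK gK sg]]]; have fI := can_inj fK.
split=> //; split=> // F [[LF maxF] nF].
have FL := vertices_simplex LF.
split; last exact: nonunitary_vimage.
split=> [|G KG FG]; first exact: sf.
have <- : vimage g G = F.
  by apply: maxF; [exact: sg | rewrite -(vimageK fK FL); exact: vimageS].
by rewrite (vimageK gK) //; exact: vertices_simplex.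
Qed.

Lemma isomorphic_sym (T U : Type) (L : complex T) (K : complex U) :
  isomorphic L K -> isomorphic K L.
Proof. by move=> [f [sf [g [fK gK sg]]]]; exists g; split=> //; exists f. Qed.

(** Since vertex maps live on subtypes, restricting [f] changes both its domain and its codomain.
    Agreement with [f] is therefore expressed on underlying points, for any vertex [y] of [L] lying
    over the same point as [x]. *)
Lemma vmap_restrict (T U : Type) (L M : complex T) (K N : complex U)
    (f : vmap L K) (ML : subcomplex M L) :
  (forall F, simplices M F -> simplices N (vimage f F)) ->
  exists2 h : vmap M N,
    forall (x : vertices M) (y : vertices L),
      \val x = \val y -> \val (h x) = \val (f y) &
    simplicial h.
Proof.
move=> fMN.
have incl_in (x : vertices M) : vertices L (\val x).
  exact: vertices_subcomplex ML _ (set_mem (valP x)).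
pose incl (x : vertices M) : vertices L :=
    exist _ (\val x) (mem_set (incl_in x)).
have f_in x : vertices N (\val (f (incl x))).
  have [F MF Fx] := set_mem (valP x).
  by exists (vimage f F); [exact: fMN | exists (incl x)].
pose h : vmap M N := fun x =>
    exist _ (\val (f (incl x))) (mem_set (f_in x)).
exists h => [x y xy|F MF]; first by have -> : y = incl x by exact/val_inj.
(* Only one inclusion between the two images is needed, as [N] is closed under subsets. *)
apply: (simplices_sub (fMN _ MF)) => _ [x Fx <-].
by exists (incl x).
Qed.

Section Pullback.
Variables (T U : Type) (L : complex T) (K : complex U) (f : vmap L K).
Variable M : complex U.

Lemma pullback_sub (F G : set T) :
  simplices L F /\ simplices M (vimage f F) -> G `<=` F ->
  simplices L G /\ simplices M (vimage f G).
Proof.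
move=> [LF MF] GF; split; first exact: simplices_sub LF GF.
exact: simplices_sub MF (vimageS GF).
Qed.

(** Membership in [L] is required separately: a set whose image is a simplex need not be a simplex,
    if only because [vimage] ignores points that are not vertices. *)
Definition pullback : complex T := Complex pullback_sub.

Lemma pullback_subcomplex : subcomplex pullback L.
Proof. by move=> F []. Qed.

Lemma pullback_isomorphic :
  isomorphism f -> subcomplex M K -> isomorphic pullback M.
Proof.
move=> [sf [g [fK gK sg]]] MK.
have [|f' f'E sf'] := @vmap_restrict _ _ _ _ _ M f pullback_subcomplex.
  by move=> F [].
have [|g' g'E sg'] := @vmap_restrict _ _ _ _ _ pullback g MK.
  move=> F MF; split; first exact/sg/MK.
  by rewrite (vimageK gK) //; exact/vertices_simplex/MK.
(* The restrictions cancel because, on underlying points, they agree with [f] and [g]. *)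
exists f'; split=> //; exists g'; split=> // x; apply/val_inj.
- have Lx := vertices_subcomplex pullback_subcomplex (set_mem (valP x)).
  pose y : vertices L := exist _ (\val x) (mem_set Lx).
  by rewrite (g'E _ (f y)) ?fK // (f'E _ y).
- have Kx := vertices_subcomplex MK (set_mem (valP x)).
  pose y : vertices K := exist _ (\val x) (mem_set Kx).
  by rewrite (f'E _ (g y)) ?gK // (g'E _ y).
Qed.

End Pullback.

(** The image of a simplex of [L'] is a simplex of [L], so it lies in some [Ls i], which puts the
    original simplex in the corresponding pullback. *)
Lemma covered_by_isomorphic (T T' : Type) (L : complex T) (L' : complex T')
    (k : nat) (Ls : 'I_k -> complex T) :
  isomorphic L' L -> covered_by L Ls ->
  exists Ls' : 'I_k -> complex T',
    covered_by L' Ls' /\ forall i, isomorphic (Ls' i) (Ls i).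
Proof.
move=> [f isof] [LsL LE]; exists (fun i => pullback f (Ls i)); split.
  split=> [i|]; first exact: pullback_subcomplex.
  apply/seteqP; split=> [F L'F|F [i _ []] //].
  have : simplices L (vimage f F) by case: isof => sf _; exact: sf.
  by rewrite LE => -[i _ LiF]; exists i.
by move=> i; exact: pullback_isomorphic.
Qed.

Lemma eq_least (P Q : nat -> Prop) :
  (forall k, P k <-> Q k) -> least P = least Q.
Proof. by move=> PQ; congr least; apply/funext => k; exact/propext. Qed.

Section Transport.
Variables (T T' U U' : Type) (L : complex T) (L' : complex T').
Variables (H : complex U) (H' : complex U').
Hypotheses (isoL : isomorphic L' L) (isoH : isomorphic H H').

(** The two isomorphisms are oriented so that each new member maps to [H'] through the old member
    and then [H]. *)
Lemma facet_cover_isomorphic (k : nat) :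
  (exists Ls : 'I_k -> complex T, covered_by L Ls /\
    forall i, exists f : vmap (Ls i) H, facet_simplicial f) ->
  exists Ls : 'I_k -> complex T', covered_by L' Ls /\
    forall i, exists f : vmap (Ls i) H', facet_simplicial f.
Proof.
move=> [Ls [cLs fLs]].
have [Ls' [cLs' isoLs]] := covered_by_isomorphic isoL cLs.
exists Ls'; split=> // i.
have [f ff] := fLs i.
have [u /isomorphism_injective_facet_simplicial[fu _]] := isoLs i.
have [v /isomorphism_injective_facet_simplicial[fv _]] := isoH.
exists (v \o (f \o u)).
exact: facet_simplicial_comp (facet_simplicial_comp fu ff) fv.
Qed.

Lemma injective_facet_cover_isomorphic (k : nat) :
  (exists Ls : 'I_k -> complex T, covered_by L Ls /\
    forall i, exists f : vmap (Ls i) H, injective_facet_simplicial f) ->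
  exists Ls : 'I_k -> complex T', covered_by L' Ls /\
    forall i, exists f : vmap (Ls i) H', injective_facet_simplicial f.
Proof.
move=> [Ls [cLs fLs]].
have [Ls' [cLs' isoLs]] := covered_by_isomorphic isoL cLs.
exists Ls'; split=> // i.
have [f ff] := fLs i.
have [u /isomorphism_injective_facet_simplicial fu] := isoLs i.
have [v /isomorphism_injective_facet_simplicial fv] := isoH.
exists (v \o (f \o u)).
exact: injective_facet_simplicial_comp
  (injective_facet_simplicial_comp fu ff) fv.
Qed.

End Transport.

Theorem corollary3p9 (T T' U U' : Type)
    (L : complex T) (L' : complex T') (H : complex U) (H' : complex U') :
  isomorphic L' L -> isomorphic H' H ->
  facet_complexity L H = facet_complexity L' H' /\
  injective_facet_complexity L H = injective_facet_complexity L' H'.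
Proof.
move=> isoL isoH.
have isoL' := isomorphic_sym isoL; have isoH' := isomorphic_sym isoH.
(* The same numbers [k] are admissible on both sides; the converse implications use the inverse
   isomorphisms. *)
split; apply: eq_least => k; split=> -[k0 cov]; split=> //.
- exact: facet_cover_isomorphic isoL isoH' _ cov.
- exact: facet_cover_isomorphic isoL' isoH _ cov.
- exact: injective_facet_cover_isomorphic isoL isoH' _ cov.
- exact: injective_facet_cover_isomorphic isoL' isoH _ cov.
Qed.
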